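(* For the optimal scoring rule $S(q,p)=s^*(q)-p$, one has $s^{*\prime}(q)\le V'(q)$ for every $q$ in the range $q^*_{sym}([0,1))$.
   Context: Setting. There are $n\ge2$ firms with types $\theta_i\in[0,1]$, i.i.d. with cdf $F$ and strictly positive density $f$. $V:\mathbb R_+\to\mathbb R$ is the buyer's value of quality; $C^P,C^I:\mathbb R_+\times[0,1]\to\mathbb R_+$ are production (winner-pay) and investment (all-pay) costs; all functions are as smooth as needed. Virtual costs: $\tilde C^P=C^P+C^P_\theta F/f$, $\tilde C^I=C^I+C^I_\theta F/f$ (subscripts denote partial derivatives). Standing assumptions. For $q>0$, $\theta\in(0,1)$: $C^P_q,C^P_\theta,C^I_q,C^I_\theta,C^P_{q\theta},C^I_{q\theta}>0$; $C^I(0,\theta)=C^I_q(0,\theta)=0$; $V'\ge0$, $V''\le0$; $\tilde C^P_\theta>0$, $\tilde C^P_{qq}>0$, $\tilde C^P_{q\theta}\ge0$, $\tilde C^I_\theta>0$, $\tilde C^I_{qq}>0$, $\tilde C^I_{q\theta}\ge0$. For every $\theta\in[0,1]$: $V'(0)>\tilde C^P_q(0,\theta)$, and $V'(q)<\tilde C^P_q(q,\theta)+\tilde C^I_q(q,\theta)$ for all large $q$. Optimal symmetric quality function: for $\theta\in[0,1)$, $q=q^*_{sym}(\theta)$ solves $V'(q)=\tilde C^P_q(q,\theta)+\tilde C^I_q(q,\theta)/(1-F(\theta))^{n-1}$; it is decreasing, with inverse denoted $\theta(q)$. Optimal scoring rule: $s^*$ satisfies $s^{*\prime}(q)=C^P_q(q,\theta(q))+C^I_q(q,\theta(q))/(1-F(\theta(q)))^{n-1}$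 on the range of $q^*_{sym}$. *)

(* Defs.v *)
From HB Require Import structures.
From mathcomp Require Import all_boot all_order all_algebra.
From mathcomp Require Import all_classical all_reals all_analysis.

Set Implicit Arguments.
Unset Strict Implicit.
Unset Printing Implicit Defensive.

Import Order.TTheory GRing.Theory Num.Theory numFieldNormedType.Exports.

Local Open Scope classical_set_scope.
Local Open Scope ring_scope.

Section RelativeDerivatives.
Context {R : realType}.
Implicit Types (D : set R) (g : R -> R) (C : R -> R -> R).

(* Derivatives are taken relative to the domain of the function: one-sided at
   a boundary point, the usual derivative at an interior point.  The values of
   a function outside its domain are irrelevant. *)
Definition diff_quot D g (x : R) : set_system R :=
  (g y - g x) / (y - x) @[y --> within D x^'].

Definition derivable_on D g (x : R) : Prop := cvg (diff_quot D g x).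

Definition deriv_on D g (x : R) : R := lim (diff_quot D g x).

Definition quality_dom : set R := `[0, +oo[.
Definition type_dom : set R := `[0, 1].

Fixpoint Ck_on (k : nat) D g : Prop :=
  {within D, continuous g} /\
  if k is k'.+1 then
    (forall x, D x -> derivable_on D g x) /\ Ck_on k' D (deriv_on D g)
  else True.

Definition partial_q C (q t : R) : R := deriv_on quality_dom (fun x => C x t) q.
Definition partial_t C (q t : R) : R := deriv_on type_dom (fun x => C q x) t.

Fixpoint Ck_cost (k : nat) C : Prop :=
  {within quality_dom `*` type_dom, continuous (fun z : R * R => C z.1 z.2)} /\
  if k is k'.+1 then
    [/\ forall q t, quality_dom q -> type_dom t ->
          derivable_on quality_dom (fun x => C x t) q
          /\ derivable_on type_dom (fun x => C q x) t,
        Ck_cost k' (partial_q C)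
      & Ck_cost k' (partial_t C)]
  else True.

Definition virtual_cost (F f : R -> R) C (q t : R) : R :=
  C q t + partial_t C q t * F t / f t.

End RelativeDerivatives.

(* The product rule over the whole family yields the one over every subfamily,
   by taking [A i = setT]. *)
Definition mutually_independent (R : realType) (d : measure_display)
    (T : measurableType d) (P : probability T R) (n : nat)
    (X : 'I_n -> {RV P >-> R}) : Prop :=
  forall A : 'I_n -> set R, (forall i, measurable (A i)) ->
    P [set w | forall i, A i (X i w)] = (\prod_(i < n) P (X i @^-1` A i))%E.

Record iid_types (R : realType) (d : measure_display) (T : measurableType d)
    (P : probability T R) (n : nat) (X : 'I_n -> {RV P >-> R})
    (F f : R -> R) : Prop := IidTypes {
  types_range : forall i w, type_dom (X i w);
  types_indep : mutually_independent X;
  types_cdf : forall i t, cdf (X i) t = (F t)%:E;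
  types_density : forall t, type_dom t ->
    (F t)%:E = (\int[lebesgue_measure]_(u in `[0%R, t]) (f u)%:E)%E;
  density_gt0 : forall t, type_dom t -> 0 < f t }.

(* The orders of smoothness are the least for which every derivative occurring
   in [standing_assumptions] is defined and continuous up to the boundary. *)
Record smooth_primitives (R : realType) (f V : R -> R) (CP CI : R -> R -> R) :
    Prop := SmoothPrimitives {
  smooth_f : Ck_on 1 type_dom f;
  smooth_V : Ck_on 2 quality_dom V;
  smooth_CP : Ck_cost 3 CP;
  smooth_CI : Ck_cost 3 CI }.

Record standing_assumptions (R : realType) (F f V : R -> R)
    (CP CI : R -> R -> R) : Prop := StandingAssumptions {
  cost_ge0 : forall q t, quality_dom q -> type_dom t ->
    0 <= CP q t /\ 0 <= CI q t;
  CP_mono : forall q t, 0 < q -> 0 < t < 1 ->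
    [/\ 0 < partial_q CP q t, 0 < partial_t CP q t
      & 0 < partial_t (partial_q CP) q t];
  CI_mono : forall q t, 0 < q -> 0 < t < 1 ->
    [/\ 0 < partial_q CI q t, 0 < partial_t CI q t
      & 0 < partial_t (partial_q CI) q t];
  CI_at0 : forall t, 0 < t < 1 -> CI 0 t = 0 /\ partial_q CI 0 t = 0;
  V_shape : forall q, 0 < q ->
    0 <= deriv_on quality_dom V q /\
    deriv_on quality_dom (deriv_on quality_dom V) q <= 0;
  virtual_CP : forall q t, 0 < q -> 0 < t < 1 ->
    [/\ 0 < partial_t (virtual_cost F f CP) q t,
        0 < partial_q (partial_q (virtual_cost F f CP)) q t
      & 0 <= partial_t (partial_q (virtual_cost F f CP)) q t];
  virtual_CI : forall q t, 0 < q -> 0 < t < 1 ->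
    [/\ 0 < partial_t (virtual_cost F f CI) q t,
        0 < partial_q (partial_q (virtual_cost F f CI)) q t
      & 0 <= partial_t (partial_q (virtual_cost F f CI)) q t];
  V_at0 : forall t, type_dom t ->
    partial_q (virtual_cost F f CP) 0 t < deriv_on quality_dom V 0;
  V_at_infty : forall t, type_dom t -> \forall q \near +oo,
    deriv_on quality_dom V q <
      partial_q (virtual_cost F f CP) q t + partial_q (virtual_cost F f CI) q t
  }.

(* [qsym] is only meaningful on [0, 1[, and [tinv] on [qsym @` `[0, 1[]. *)
Record optimal_symmetric_quality (R : realType) (n : nat) (F f V : R -> R)
    (CP CI : R -> R -> R) (qsym tinv : R -> R) : Prop :=
    OptimalSymmetricQuality {
  qsym_dom : forall t, 0 <= t < 1 -> quality_dom (qsym t);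
  qsym_foc : forall t, 0 <= t < 1 ->
    deriv_on quality_dom V (qsym t) =
      partial_q (virtual_cost F f CP) (qsym t) t
      + partial_q (virtual_cost F f CI) (qsym t) t / (1 - F t) ^+ n.-1;
  qsym_decr : forall t u, 0 <= t < 1 -> 0 <= u < 1 -> t < u -> qsym u < qsym t;
  qsym_inv : forall t, 0 <= t < 1 -> tinv (qsym t) = t }.

Definition qsym_range (R : realType) (qsym : R -> R) : set R :=
  qsym @` `[0, 1[.

(* [S] is quasi-linear in the price, and the marginal score is prescribed on
   the range of [qsym] only; at the end point [qsym 0] of that range the
   derivative of [s] is the one taken from inside the range. *)
Record optimal_scoring_rule (R : realType) (n : nat) (F : R -> R)
    (CP CI : R -> R -> R) (qsym tinv : R -> R) (s : R -> R)
    (S : R -> R -> R) : Prop := OptimalScoringRule {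
  score_quasilinear : forall q p, quality_dom q -> S q p = s q - p;
  score_derivable : forall q, qsym_range qsym q ->
    derivable_on (qsym_range qsym) s q;
  score_deriv : forall q, qsym_range qsym q ->
    deriv_on (qsym_range qsym) s q =
      partial_q CP q (tinv q)
      + partial_q CI q (tinv q) / (1 - F (tinv q)) ^+ n.-1 }.

(* Main.v *)
(* At t = tinv q the first-order condition for [qsym] and the formula for [s']
   differ only by the information-rent terms C_tq F / f, so it suffices that
   these are nonnegative.  At t = 0 they vanish with F.  For 0 < t < 1 only the
   sign of C_qt is assumed; instead of equality of the mixed derivatives we use
   that C_qt >= 0 gives C increasing differences, hence C_t is nondecreasing in
   q, hence C_tq >= 0.  Strict monotonicity of [qsym] keeps q away from 0. *)
Require Import Defs.
From mathcomp Require Import all_boot all_order all_algebra.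
From mathcomp Require Import all_classical all_reals all_analysis.
From mathcomp Require Import lra.

Import Order.TTheory GRing.Theory Num.Theory numFieldNormedType.Exports.

Local Open Scope classical_set_scope.
Local Open Scope ring_scope.

Section InteriorDerivatives.
Context {R : realType}.
Implicit Types (D : set R) (g h : R -> R) (x y l : R).

Lemma within_dnbhs_interior D x : D° x -> within D x^' = x^'.
Proof.
move=> Dx; rewrite eqEsubset; split; last by move=> A; apply: filterS => y Ay _.
move=> A DA; have Dn : x^' D by exact: (nbhs_dnbhs Dx).
by apply: filterS2 Dn DA => y Dy; apply.
Qed.

Lemma dnbhs_shift x : x^' = (h + x @[h --> 0^']).
Proof.
rewrite eqEsubset; split=> A /nbhs_ballP[e /= e0 xA]; apply/nbhs_ballP.
  exists e => //= h; rewrite /ball/= sub0r normrN => he h0.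
  apply: xA; first by rewrite /ball/= opprD addrA addrAC subrr sub0r normrN.
  by rewrite -subr_eq0 addrK.
exists e => //= y; rewrite /ball/= => ye yx; rewrite -(subrK x y).
by apply: xA; rewrite ?subr_eq0 // /ball/= sub0r opprB.
Qed.

(** At an interior point the restriction to [D] drops out, and the substitution [y = h + x] turns
    the quotient into the one behind [derive]. This opens relative derivatives to the [is_derive]
    rules and the mean value theorem. *)
Lemma diff_quot_interior D g x : D° x ->
  diff_quot D g x = (h^-1 *: ((g \o shift x) (h *: 1) - g x) @[h --> 0^']).
Proof.
move=> Dx.
rewrite /diff_quot (within_dnbhs_interior _ _ Dx) dnbhs_shift -fmap_comp.
apply: (congr1 (fun k => k @ 0^')); apply/funext => h /=.
by rewrite addrK [h%:A]mulr1 mulrC.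
Qed.

Lemma deriv_on_is_derive D g x :
  D° x -> derivable_on D g x -> is_derive x 1 g (deriv_on D g x).
Proof.
rewrite /derivable_on /deriv_on => Dx; rewrite (diff_quot_interior _ _ _ Dx).
by move=> gx; split.
Qed.

Lemma is_derive_deriv_on D g x l :
  D° x -> is_derive x 1 g l -> deriv_on D g x = l.
Proof.
by rewrite /deriv_on => Dx [_ <-]; rewrite (diff_quot_interior _ _ _ Dx).
Qed.

Lemma is_derive_ge0_le g dg x y : x <= y ->
  (forall z, z \in `[x, y] -> is_derive z 1 g (dg z)) ->
  (forall z, z \in `[x, y] -> 0 <= dg z) -> g x <= g y.
Proof.
move=> xy gdg dg_ge0.
have sub : {subset `]x, y[ <= `[x, y]} by exact: subset_itv_oo_cc.
have gc : {within `[x, y], continuous g}.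
  by apply: derivable_within_continuous => z /gdg[].
have [z zxy gE] := MVT_segment xy (fun z zxy => gdg z (sub z zxy)) gc.
by rewrite -subr_ge0 gE mulr_ge0 ?subr_ge0 ?dg_ge0.
Qed.

(** Numerator and denominator of a difference quotient have the same sign, and limits keep weak
    inequalities. [D] can be any neighbourhood of [x] on which monotonicity is known. *)
Lemma is_derive_ndecr_ge0 D g x l : D° x -> is_derive x 1 g l ->
  {in D &, {homo g : y z / y <= z}} -> 0 <= l.
Proof.
move=> Dx [gx <-] gD.
have Dn : x^' D by exact: nbhs_dnbhs Dx.
have Dx' : x \in D by rewrite inE; exact: interior_subset.
have := diff_quot_interior _ g _ Dx.
rewrite /derive /diff_quot (within_dnbhs_interior _ _ Dx) => E.
move: gx; rewrite /derivable -E => gx.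
apply: limr_ge => //; apply: filterS Dn => y /mem_set Dy.
have [yx|xy] := leP y x.
  by rewrite -mulrNN -invrN !opprB mulr_ge0 ?invr_ge0 ?subr_ge0 ?gD.
by rewrite mulr_ge0 ?invr_ge0 ?subr_ge0 ?gD // ltW.
Qed.

End InteriorDerivatives.

Section CostFunctions.
Context {R : realType}.
Implicit Types (C : R -> R -> R) (F f : R -> R) (p q t u v : R).

Lemma quality_dom_interior q : 0 < q -> quality_dom° q.
Proof. by move=> q0; rewrite interior_itv_bndy /= in_itv/= q0. Qed.

Lemma type_dom_interior t : 0 < t < 1 -> type_dom° t.
Proof. by move=> t01; rewrite interior_itv_bnd /= in_itv. Qed.

Lemma type_domW t : 0 < t < 1 -> type_dom t.
Proof. by move=> /type_dom_interior; exact: interior_subset. Qed.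

Lemma Ck_costW k C : Ck_cost k.+1 C -> Ck_cost k C.
Proof.
elim: k C => [|k IHk] C [Cc]; first by move=> _; split.
by case=> dC Cq Ct; exact: (conj Cc (And3 dC (IHk _ Cq) (IHk _ Ct))).
Qed.

Lemma Ck_cost_partial_q k C : Ck_cost k.+1 C -> Ck_cost k (partial_q C).
Proof. by case=> _ [_ Cq _]; exact: Cq. Qed.

Lemma Ck_cost_partial_t k C : Ck_cost k.+1 C -> Ck_cost k (partial_t C).
Proof. by case=> _ [_ _ Ct]; exact: Ct. Qed.

(** Only the variable of differentiation has to be interior, so the boundary types 0 and 1 are
    covered. *)
Lemma is_derive_partial_q k C q t : Ck_cost k.+1 C -> 0 < q -> type_dom t ->
  is_derive q 1 (C ^~ t) (partial_q C q t).
Proof.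
move=> [_ [dC _ _]] /quality_dom_interior q0 t01.
apply: deriv_on_is_derive => //.
by have [] := dC q t (interior_subset q0) t01.
Qed.

Lemma is_derive_partial_t k C q t : Ck_cost k.+1 C -> 0 < q -> 0 < t < 1 ->
  is_derive t 1 (C q) (partial_t C q t).
Proof.
move=> [_ [dC _ _]] /quality_dom_interior q0 /type_dom_interior t01.
apply: deriv_on_is_derive => //.
by have [] := dC q t (interior_subset q0) (interior_subset t01).
Qed.

(** The mean value theorem is used twice: in the type, where C_qt >= 0 makes [partial_q C x]
    nondecreasing, then in quality, for [C x v - C x u]. *)
Lemma increasing_differences C p q u v : Ck_cost 2 C ->
  (forall x t, 0 < x -> 0 < t < 1 -> 0 <= partial_t (partial_q C) x t) ->
  0 < p -> p <= q -> 0 < u -> u <= v -> v < 1 ->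
  C q u - C p u <= C q v - C p v.
Proof.
move=> C2 Cqt p0 pq u0 uv v1.
have uv01 t : t \in `[u, v] -> 0 < t < 1.
  by rewrite in_itv/= => /andP[ut tv];
    rewrite (lt_le_trans u0) ?(le_lt_trans tv).
have x0 x : x \in `[p, q] -> 0 < x.
  by rewrite in_itv/= => /andP[px _]; exact: lt_le_trans px.
have [uI vI] : u \in `[u, v] /\ v \in `[u, v] by rewrite !in_itv/= !lexx uv.
suff : C p v - C p u <= C q v - C q u by rewrite !lerBlDr; lra.
pose dg x := partial_q C x v - partial_q C x u.
apply: (is_derive_ge0_le (fun x => C x v - C x u) dg) => // x /x0 {}x0.
  by apply: is_deriveB; apply: (is_derive_partial_q _ _ _ _ C2) => //;
     apply: type_domW; exact: uv01.
rewrite subr_ge0.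
apply: (is_derive_ge0_le (partial_q C x) (partial_t (partial_q C) x))
  => // t /uv01 t01.
  have Cq := Ck_cost_partial_q _ _ C2.
  exact: (is_derive_partial_t _ _ _ _ Cq).
exact: Cqt.
Qed.

Lemma partial_qt_ge0 C q t : Ck_cost 2 C ->
  (forall x u, 0 < x -> 0 < u < 1 -> 0 <= partial_t (partial_q C) x u) ->
  0 < q -> 0 < t < 1 -> 0 <= partial_q (partial_t C) q t.
Proof.
move=> C2 Cqt q0 t01.
have Ct := Ck_cost_partial_t _ _ C2.
(* The open half-line replaces [quality_dom], because the comparison below is made at positive
   qualities. *)
have qI : (`]0, +oo[ : set R)° q by rewrite interior_itv_bndy /= in_itv/= q0.
apply: (is_derive_ndecr_ge0 _ _ _ _ qI
  (is_derive_partial_q _ _ _ _ Ct q0 (type_domW _ t01))).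
move=> x y; rewrite !inE/= !in_itv/= !andbT => x0 y0 xy.
have tI : (`]0, 1[ : set R)° t by rewrite interior_itv_bnd /= in_itv.
(* The difference of the two values of C_t is the derivative at [t] of [C y - C x], which increasing
   differences make nondecreasing on ]0, 1[. *)
rewrite -subr_ge0; apply: (is_derive_ndecr_ge0 _ _ _ _ tI
  (is_deriveB (is_derive_partial_t _ _ _ _ C2 y0 t01)
              (is_derive_partial_t _ _ _ _ C2 x0 t01))).
move=> u v; rewrite !inE/= !in_itv/= => /andP[u0 _] /andP[_ v1] uv.
exact: increasing_differences.
Qed.

Lemma partial_q_virtual_cost F f C q t : Ck_cost 2 C -> 0 < q -> type_dom t ->
  partial_q (virtual_cost F f C) q t =
  partial_q C q t + partial_q (partial_t C) q t * (F t / f t).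
Proof.
move=> C2 q0 t01; apply: is_derive_deriv_on; first exact: quality_dom_interior.
have Ct := Ck_cost_partial_t _ _ C2.
(* For fixed [t] the factor [F t / f t] is constant, so the rent is a scalar multiple of C_t as a
   function of quality. *)
have -> : (virtual_cost F f C) ^~ t =
    (C ^~ t) + (F t / f t) \*: (partial_t C ^~ t).
  by apply/funext => x; rewrite /virtual_cost -mulrA [_ * (_ / _)]mulrC.
rewrite [_ * (_ / _)]mulrC; apply: is_deriveD.
  exact: (is_derive_partial_q _ _ _ _ C2).
by apply: is_deriveZ; exact: (is_derive_partial_q _ _ _ _ Ct).
Qed.

Lemma partial_q_le_virtual_cost F f C q t : Ck_cost 2 C ->
  (forall x u, 0 < x -> 0 < u < 1 -> 0 <= partial_t (partial_q C) x u) ->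
  F 0 = 0 -> 0 <= F t -> 0 < f t -> 0 < q -> 0 <= t < 1 ->
  partial_q C q t <= partial_q (virtual_cost F f C) q t.
Proof.
move=> C2 Cqt F0 Ft ft q0 /andP[t0 t1].
rewrite partial_q_virtual_cost //; last by rewrite /type_dom/= in_itv/= t0 ltW.
(* Type 0 is split off, since [Cqt] gives a sign only at interior types. *)
rewrite lerDl; move: t0 Ft; rewrite le_eqVlt => /predU1P[<-|t0] Ft.
  by rewrite F0 mul0r mulr0.
by rewrite mulr_ge0 ?divr_ge0 ?(ltW ft) // partial_qt_ge0 // t0.
Qed.

End CostFunctions.

Theorem proposition3 (R : realType) (n : nat) (d : measure_display)
    (T : measurableType d) (P : probability T R) (X : 'I_n -> {RV P >-> R})
    (F f V : R -> R) (CP CI : R -> R -> R) (qsym tinv : R -> R)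
    (s : R -> R) (S : R -> R -> R)
    (hn : (2 <= n)%N)
    (htypes : iid_types X F f)
    (hsmooth : smooth_primitives f V CP CI)
    (hstand : standing_assumptions F f V CP CI)
    (hqsym : optimal_symmetric_quality n F f V CP CI qsym tinv)
    (hscore : optimal_scoring_rule n F CP CI qsym tinv s S) :
  forall q : R, qsym_range qsym q ->
    deriv_on (qsym_range qsym) s q <= deriv_on quality_dom V q.
Proof.
move=> q qr; rewrite (score_deriv hscore) //.
case: qr => t; rewrite /= in_itv/= => t01 <-.
rewrite (qsym_inv hqsym) // (qsym_foc hqsym) //.
have /andP[t0 t1] := t01.
have tD : type_dom t by rewrite /type_dom/= in_itv/= t0 ltW.
have q0 : 0 < qsym t.
  (* Any type in ]t, 1[ serves, here the midpoint: its quality is nonnegative and [qsym t] is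
     strictly larger. *)
  have u01 : 0 <= (t + 1) / 2 < 1 by lra.
  have tu : t < (t + 1) / 2 by lra.
  apply: le_lt_trans (qsym_decr hqsym t01 u01 tu).
  by have := qsym_dom hqsym u01; rewrite /quality_dom/= in_itv/= andbT.
(* [hn] provides a firm, and the bounds on its cdf pass to [F]. *)
pose i : 'I_n := Ordinal (ltnW hn).
have Fge0 : 0 <= F t by rewrite -lee_fin -(types_cdf htypes i) cdf_ge0.
have Fle1 : F t <= 1 by rewrite -lee_fin -(types_cdf htypes i) cdf_le1.
(* The density formula excludes an atom at 0: the integral over the degenerate interval [0, 0] is
   zero. *)
have F0 : F 0 = 0.
  apply: EFin_inj; rewrite (types_density htypes); last first.
    by rewrite /type_dom/= in_itv/= lexx ler01.
  by rewrite set_itv1 integral_set1.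
have ft := density_gt0 htypes tD.
(* Production and investment terms are compared separately; the latter share the weight 1 / (1 - F
   t)^(n-1), nonnegative as [F t <= 1]. *)
apply: lerD; last apply: ler_wpM2r.
- apply: partial_q_le_virtual_cost => //;
    first exact: Ck_costW (smooth_CP hsmooth).
  by move=> x u x0 u01; have [_ _ /ltW] := CP_mono hstand x0 u01.
- by rewrite invr_ge0 exprn_ge0 // subr_ge0.
- apply: partial_q_le_virtual_cost => //;
    first exact: Ck_costW (smooth_CI hsmooth).
  by move=> x u x0 u01; have [_ _ /ltW] := CI_mono hstand x0 u01.
Qed.
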